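(* Let $l_1>l_2>\cdots>l_J$ be the free-flow travel times, and let the commuting disutility be $$c_{j,k}(s)=\alpha_kl_j+\beta_kf(s)+\gamma_kg(s-l_j)\quad(s\le0),\qquad c_{j,k}(s)=+\infty\quad(s>0),$$ for $j\in\mathcal J=\{1,\dots,J\}$, $k\in\mathcal K=\{1,\dots,K\}$, where $0<\alpha_1<\cdots<\alpha_K$, $0<\beta_1<\cdots<\beta_K$, $0<\gamma_1<\cdots<\gamma_K$; $f$ is continuous on $(-\infty,0]$ with $f\ge0$ and $f'(s)<0$ for all $s\le0$; and $g$ is continuous with $g(t)>0$, $g'(t)<0$, $g''(t)<0$ for all $t\le-l_J$. Let $\mu>0$, $R_j>0$, $Q_k>0$ with $\sum_jR_j=\sum_kQ_k=Q$, $T=Q/\mu$. Let $\mathbf{x}^*$ be the equilibrium flow pattern, i.e. the solution of $$\min_{\mathbf{x}\ge0}\ \sum_{j}\sum_{k}\int_{\mathcal S}c_{j,k}(s)x_{j,k}(s)\,\mathrm{d}s$$ subject to $\sum_j\sum_kx_{j,k}(s)\le\mu$ for all $s\in\mathcal S$, $\ \sum_k\int_{\mathcal S}x_{j,k}(s)\,\mathrm{d}s\le R_j$ for all $j$, $\ \sum_j\int_{\mathcal S}x_{j,k}(s)\,\mathrm{d}s\ge Q_k$ for all $k$. Let the groups $i=1,\dots,I$, with associated pairs $(j(i),k(i))$ and masses $X_i$, be those produced by the northwest corner rule applied to $\{R_j\}$ and $\{Q_k\}$ (see context), and define $s_i=\sum_{i'\le i}X_{i'}/\mu-T$ for $i=0,1,\dots,I$.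 Then $\mathbf{x}^*$ has the sorting property: for each $i$ all users in group $i$ depart from the bottleneck in the time interval $[s_{i-1},s_i]$ of length $X_i/\mu$ (i.e. for almost every $s\in[s_{i-1},s_i]$ the only nonzero flow is $x^*_{j(i),k(i)}(s)$, and $\mathbf{x}^*(s)=0$ for almost every $s\in\mathcal S\setminus[-T,0]$), and $$s_0=-T<s_1<s_2<\cdots<s_{I-1}<s_I=0 .$$
   Context: $\mathcal S\subset\mathbb R$ is a given, sufficiently long time interval (containing $[-T,0]$). The unknowns $x_{j,k}$ are nonnegative measurable functions on $\mathcal S$: $x_{j,k}(s)$ is the flow rate of users living at location $j$ with job $k$ departing at time $s$ from a single bottleneck of capacity $\mu$; constraints on $s$ hold for almost every $s$. Cost $+\infty$ for $s>0$ means $x_{j,k}(s)=0$ for almost every $s>0$. Northwest corner rule: (0) set $i:=1$, $j:=1$, $k:=1$. (1) Set $(j(i),k(i)):=(j,k)$ and $X_i:=\min\{R_j,Q_k\}$ (current values). (2) Replace $R_j$ by $R_j-X_i$ and $Q_k$ by $Q_k-X_i$; each of the indices $j$, $k$ whose quantity ($R_j$, respectively $Q_k$) has become zero is increased by one. (3) If $\sum_{i'\le i}X_{i'}=Q$, set $I:=i$ and stop; otherwise set $i:=i+1$ and return to step (1). Group $i$ consists of the users of type $(j(i),k(i))$. *)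

(* Defs.v *)
From HB Require Import structures.
From mathcomp Require Import all_boot all_order all_algebra.
From mathcomp Require Import all_classical all_reals all_analysis.

Set Implicit Arguments.
Unset Strict Implicit.
Unset Printing Implicit Defensive.

Import Order.TTheory GRing.Theory Num.Theory.
Import numFieldNormedType.Exports.

Local Open Scope classical_set_scope.
Local Open Scope ring_scope.

(* The locations are 'I_J.+1 and the jobs are 'I_K.+1, so that there is at
   least one of each; the last location is ord_max. *)

(* Derivative relative to a set A: the ordinary derivative at an interior point
   of A, the one-sided derivative at the endpoint of a half-line. *)
Definition has_deriv_within (R : realType) (A : set R) (f : R -> R)
    (x d : R) : Prop :=
  (f y - f x) / (y - x) @[y --> within A x^'] --> d.

Definition disutility (R : realType) (J K : nat) (l : 'I_J.+1 -> R)
    (alpha beta gamma : 'I_K.+1 -> R) (f g : R -> R)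
    (j : 'I_J.+1) (k : 'I_K.+1) (s : R) : \bar R :=
  if s <= 0 then (alpha k * l j + beta k * f s + gamma k * g (s - l j))%:E
  else +oo%E.

(* Products and sums are those of \bar R; in particular +oo * 0 = 0. *)
Definition total_cost (R : realType) (J K : nat) (S : set R)
    (c : 'I_J.+1 -> 'I_K.+1 -> R -> \bar R)
    (x : 'I_J.+1 -> 'I_K.+1 -> R -> R) : \bar R :=
  (\sum_(j < J.+1) \sum_(k < K.+1)
     \int[lebesgue_measure]_(s in S) (c j k s * (x j k s)%:E))%E.

Record feasible (R : realType) (J K : nat) (S : set R) (mu : R)
    (supply : 'I_J.+1 -> R) (demand : 'I_K.+1 -> R)
    (x : 'I_J.+1 -> 'I_K.+1 -> R -> R) : Prop := Feasible {
  flow_measurable : forall j k, measurable_fun S (x j k) ;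
  flow_ge0 : forall j k s, S s -> 0 <= x j k s ;
  flow_capacity : {ae lebesgue_measure, forall s, S s ->
    \sum_(j < J.+1) \sum_(k < K.+1) x j k s <= mu} ;
  flow_supply : forall j, (\sum_(k < K.+1)
    \int[lebesgue_measure]_(s in S) (x j k s)%:E <= (supply j)%:E)%E ;
  flow_demand : forall k, ((demand k)%:E <= \sum_(j < J.+1)
    \int[lebesgue_measure]_(s in S) (x j k s)%:E)%E }.

Definition equilibrium (R : realType) (J K : nat) (S : set R) (mu : R)
    (supply : 'I_J.+1 -> R) (demand : 'I_K.+1 -> R)
    (c : 'I_J.+1 -> 'I_K.+1 -> R -> \bar R)
    (x : 'I_J.+1 -> 'I_K.+1 -> R -> R) : Prop :=
  feasible S mu supply demand x /\
  forall y, feasible S mu supply demand y ->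
    (total_cost S c x <= total_cost S c y)%E.

Record nwc_state (R : realType) (J K : nat) := NwcState {
  nwc_supply : 'I_J.+1 -> R ;
  nwc_demand : 'I_K.+1 -> R ;
  nwc_loc : 'I_J.+1 ;
  nwc_job : 'I_K.+1 }.

Definition nwc_mass (R : realType) (J K : nat) (st : nwc_state R J K) : R :=
  Num.min (nwc_supply st (nwc_loc st)) (nwc_demand st (nwc_job st)).

(* [inord] wraps around past the last index. This is harmless: a last index can
   only be exhausted when the whole mass has been allocated, at which point the
   rule has stopped. *)
Definition nwc_step (R : realType) (J K : nat) (st : nwc_state R J K) :
    nwc_state R J K :=
  let j := nwc_loc st in
  let k := nwc_job st in
  let r := fun j' => nwc_supply st j' - (if j' == j then nwc_mass st else 0) in
  let q := fun k' => nwc_demand st k' - (if k' == k then nwc_mass st else 0) in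
  NwcState r q (if r j == 0 then inord j.+1 else j)
               (if q k == 0 then inord k.+1 else k).

(* Groups are numbered from 0; [nwc_run supply demand i] is the state in which
   group i is formed. Only the groups before the stopping index matter. *)
Definition nwc_run (R : realType) (J K : nat)
    (supply : 'I_J.+1 -> R) (demand : 'I_K.+1 -> R) (i : nat) :
    nwc_state R J K :=
  iter i (@nwc_step R J K) (NwcState supply demand ord0 ord0).

Definition group_loc (R : realType) (J K : nat)
    (supply : 'I_J.+1 -> R) (demand : 'I_K.+1 -> R) (i : nat) : 'I_J.+1 :=
  nwc_loc (nwc_run supply demand i).

Definition group_job (R : realType) (J K : nat)
    (supply : 'I_J.+1 -> R) (demand : 'I_K.+1 -> R) (i : nat) : 'I_K.+1 :=
  nwc_job (nwc_run supply demand i).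

Definition group_mass (R : realType) (J K : nat)
    (supply : 'I_J.+1 -> R) (demand : 'I_K.+1 -> R) (i : nat) : R :=
  nwc_mass (nwc_run supply demand i).

(* The rule stops after exactly I groups, Q being the total mass. *)
Definition nwc_stops (R : realType) (J K : nat)
    (supply : 'I_J.+1 -> R) (demand : 'I_K.+1 -> R) (Q : R) (I : nat) : Prop :=
  [/\ (0 < I)%N,
      \sum_(i < I) group_mass supply demand i = Q &
      forall n, (0 < n < I)%N -> \sum_(i < n) group_mass supply demand i <> Q].

(* End of the departure interval of the first i groups. *)
Definition switch_time (R : realType) (J K : nat)
    (supply : 'I_J.+1 -> R) (demand : 'I_K.+1 -> R) (mu T : R) (i : nat) : R :=
  (\sum_(i' < i) group_mass supply demand i') / mu - T.

(* Main.v *)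
(** The cost has the Monge property in every pair of the three coordinates
    location, job and departure time: [C j k s - C j' k s] (for [j < j']) and
    [C j k s - C j k' s] (for [k < k']) increase with [s] and with the other
    index, and [C j k] decreases with [s].  The sorted flow is therefore
    certified optimal by a dual solution.  Its potentials [u], [v] make
    neighbouring types indifferent at the moment when one is exhausted and the
    next takes over, and then the active type is the unique minimizer of
    [C j k s + u j - v k] inside its interval, because any other type is beaten
    by one of its neighbours.  With the price of time normalised to vanish at
    [- T], the reduced costs are positive before [- T], where nobody departs,
    and that of the active type is negative after [- T], where capacity is
    exhausted.  Supply and demand constraints are tight since both total [Q],
    so cost and reduced cost differ by a constant over feasible flows of finite
    cost; an optimal flow then agrees with the sorted one almost everywhere, by
    strictness. *)

Require Import Defs.
From HB Require Import structures.
From mathcomp Require Import all_boot all_order all_algebra.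
From mathcomp Require Import all_classical all_reals all_analysis.
From mathcomp Require Import measurable_realfun.
From mathcomp Require Import ring lra.

Import Order.TTheory GRing.Theory Num.Theory.
Import numFieldNormedType.Exports.

Local Open Scope classical_set_scope.
Local Open Scope ring_scope.

Set Implicit Arguments.
Unset Strict Implicit.

(** * Monotonicity from derivatives *)

(** When [A] is a neighbourhood of [x], restricting the limit to [A] changes nothing, and the
    translation y = h + x turns one difference quotient into the other. *)
Lemma has_deriv_within_is_derive (R : realType) (A : set R) (f : R -> R)
    (x d : R) :
  nbhs x A -> has_deriv_within A f x d -> is_derive x 1 f d.
Proof.
move=> Ax fd.
have shift0 : (fun h : R => h + x) @ (0 : R) --> x.
  by rewrite -[X in _ --> X]add0r; apply: cvgD; [exact: cvg_id|exact: cvg_cst].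
have fd0 : (fun h => h^-1 *: (f (h *: 1 + x) - f x)) @ 0^' --> d.
  move=> P /fd; rewrite /= /fmap /dnbhs /within /= => /(filterI Ax) /shift0.
  move=> H; apply: (filterS _ (H : nbhs (0 : R) _)) => h /= [Ahx {}H] h0.
  have hx : h + x != x by rewrite -subr_eq0 addrK.
  by move: (H hx Ahx); rewrite addrK mulrC [_ *: 1]mulr1.
by apply: DeriveDef; [apply/cvg_ex; exists d|exact: (cvg_lim _ fd0)].
Qed.

(** The mean value theorem evaluates the derivative strictly between [s] and [s'], hence below [c];
    continuity up to [c] takes care of s' = c. *)
Lemma deriv_lt0_decreasing (R : realType) (c : R) (f f1 : R -> R) :
  {within [set s : R | s <= c], continuous f} ->
  (forall s, s < c -> is_derive s 1 f (f1 s) /\ f1 s < 0) ->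
  forall s s', s < s' -> s' <= c -> f s' < f s.
Proof.
move=> fc fd s s' ss' s'c.
have [||z] := @MVT _ f f1 s s' ss'.
- move=> y; rewrite in_itv /= => /andP[_ ys'].
  by have [] := fd y (lt_le_trans ys' s'c).
- apply: continuous_subspaceW fc => y /=; rewrite in_itv /= => /andP[_ ys'].
  exact: le_trans s'c.
rewrite in_itv /= => /andP[_ zs'] e.
have [_ f1z] := fd z (lt_le_trans zs' s'c).
by rewrite -subr_lt0 e nmulr_rlt0// subr_gt0.
Qed.

Lemma has_deriv_within_decreasing (R : realType) (c : R) (f f1 : R -> R) :
  {within [set s : R | s <= c], continuous f} ->
  (forall s, s <= c ->
     has_deriv_within [set s' : R | s' <= c] f s (f1 s) /\ f1 s < 0) ->
  forall s s', s < s' -> s' <= c -> f s' < f s.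
Proof.
move=> fc fd; apply: (@deriv_lt0_decreasing _ c f f1 fc) => s sc.
have [ds f1s] := fd s (ltW sc); split => //.
exact: has_deriv_within_is_derive (lt_le_nbhsl sc) ds.
Qed.

(* Only points of the open half-line are used, so nothing needs to be known
   about the one-sided derivative at the endpoint [c]. *)
Lemma concave_shift_increasing (R : realType) (c : R) (g g1 g2 : R -> R) :
  {within [set t : R | t <= c], continuous g} ->
  (forall t, t <= c ->
     [/\ has_deriv_within [set t' : R | t' <= c] g t (g1 t),
         has_deriv_within [set t' : R | t' <= c] g1 t (g2 t) & g2 t < 0]) ->
  forall d s s', 0 < d -> s < s' -> s' <= c ->
    g (s - d) - g s < g (s' - d) - g s'.
Proof.
move=> gc gd d s s' d0 ss' s'c.
have g1d t : t < c -> is_derive t 1 g1 (g2 t).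
  move=> tc; have [_ ds _] := gd t (ltW tc).
  exact: has_deriv_within_is_derive (lt_le_nbhsl tc) ds.
have g0d t : t < c -> is_derive t 1 g (g1 t).
  move=> tc; have [ds _ _] := gd t (ltW tc).
  exact: has_deriv_within_is_derive (lt_le_nbhsl tc) ds.
(* As [g2] is negative, [g1] decreases strictly, so g(t) - g(t - d) has the negative derivative
   g1(t) - g1(t - d). *)
have g1_decr t : t < c -> g1 t < g1 (t - d).
  move=> tc; apply: (@deriv_lt0_decreasing _ t g1 g2); rewrite ?gtrBl//.
    apply: continuous_in_subspaceT => y; rewrite inE /= => yt.
    apply: differentiable_continuous; apply/derivable1_diffP.
    by have [] := g1d y (le_lt_trans yt tc).
  move=> y yt; split; first exact: g1d (lt_trans yt tc).
  by have [] := gd y (ltW (lt_trans yt tc)).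
have H := @deriv_lt0_decreasing _ c (fun t => g t - g (t - d))
  (fun t => g1 t - g1 (t - d)) _ _ s s' ss' s'c.
suff : g s' - g (s' - d) < g s - g (s - d) by lra.
apply: H.
(* The shifted term is continuous up to the endpoint, since t - d is interior even for t = c. *)
- have gdc : {in [set t : R | t <= c], continuous (fun t => g (t - d))}.
    move=> t; rewrite inE /= => tc.
    apply: (@continuous_comp _ _ _ (fun t => t - d) g).
      by apply: cvgB; [exact: cvg_id|exact: cvg_cst].
    apply: differentiable_continuous; apply/derivable1_diffP.
    by have [] := g0d (t - d) ltac:(lra).
  by move=> t; apply: cvgB; [exact: gc|exact: (continuous_in_subspaceT gdc)].
- move=> t tc; split; last by rewrite subr_lt0 g1_decr.
  have tdc : t - d < c by lra.
  have h1 := g0d t tc; have h2 := g0d _ tdc.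
  apply: is_deriveB; rewrite -[g1 (t - d)]mulr1.
  apply: (@is_derive1_comp _ g (fun t => t - d)).
  rewrite -[X in is_derive _ _ _ X]subr0; apply: is_deriveB.
Qed.

(** * Dual potentials for a Monge cost *)

Lemma upward_closed_threshold (P : pred nat) (M : nat) :
  {homo P : m m' / (m <= m')%N >-> m ==> m'} -> P M ->
  exists2 k, (k <= M)%N & forall m, P m = (k <= m)%N.
Proof.
move=> Pup PM.
have exP : exists m, P m by exists M.
case: (ex_minnP exP) => k Pk kmin; exists k; first exact: kmin.
move=> m; apply/idP/idP => [/kmin//|/Pup/implyP]; exact.
Qed.

(** A minimizer exists by finiteness, and every point except [p] can be improved. Comparisons with
    neighbours thus yield a global strict minimum. *)
Lemma strict_min_of_descent (R : realDomainType) (I : finType) (V : I -> R)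
    (p : I) :
  (forall q, q != p -> exists q', V q' < V q) ->
  forall q, q != p -> V p < V q.
Proof.
move=> desc.
have min_p q : V p <= V q.
  case: (@Order.TotalTheory.arg_minP _ _ _ p xpredT V isT) => q0 _ q0min.
  have [<-|/desc[q' Vq']] := eqVneq q0 p; first exact: q0min.
  by have := q0min q' isT; rewrite leNgt Vq'.
move=> q qp; rewrite lt_neqAle min_p andbT; apply/eqP => Vpq.
by have [q' ] := desc q qp; rewrite -Vpq ltNge min_p.
Qed.

Lemma increasing_le (R : numDomainType) (r : nat -> R) :
  (forall n, r n < r n.+1) -> forall n n', (n <= n')%N -> r n <= r n'.
Proof.
move=> r_incr; apply: (@homo_leq _ _ <=%R) => [x|y x z|n].
- exact: lexx.
- exact: le_trans.
- exact: ltW.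
Qed.

Section sorting_potentials.
Variables (R : realType) (N M : nat) (C : nat -> nat -> R -> R).
Variables (a b : nat -> R) (e : R).
Hypotheses (a_incr : forall n, a n < a n.+1) (b_incr : forall m, b m < b m.+1).
Hypotheses (a_end : a N.+1 = e) (b_end : b M.+1 = e).
Hypothesis row_incr : forall n m m' s s', (n < N)%N -> (m <= m' <= M)%N ->
  s < s' -> s' <= e ->
  C n m s - C n.+1 m s < C n m' s' - C n.+1 m' s'.
Hypothesis col_incr : forall m n n' s s', (m < M)%N -> (n <= n' <= N)%N ->
  s < s' -> s' <= e ->
  C n m s - C n m.+1 s < C n' m s' - C n' m.+1 s'.

Let a_le := increasing_le a_incr.

Let b_le := increasing_le b_incr.

(* [kappa n] is the column in use when row [n] gets exhausted, and [iota m] the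
   row in use when column [m] gets exhausted; the jumps of the potentials make
   the two neighbouring cells equally expensive at that moment. *)
Lemma sorting_potentials : exists u v : nat -> R,
  forall n m s, (n <= N)%N -> (m <= M)%N ->
    a n < s < a n.+1 -> b m < s < b m.+1 ->
    forall n' m', (n' <= N)%N -> (m' <= M)%N -> (n', m') <> (n, m) ->
      C n m s + u n - v m < C n' m' s + u n' - v m'.
Proof.
(* Ties are broken by comparing non-strictly for [kappa] and strictly for [iota]: if row n < N and
   column m end together, the staircase passes through the cell (n+1, m), of zero duration, instead
   of jumping diagonally. *)
have [kappa kappaP] : exists kappa : nat -> nat, forall n, (n < N)%N ->
    (kappa n <= M)%N /\ forall m, (a n.+1 <= b m.+1) = (kappa n <= m)%N.
  suff /choice : forall n, exists k, (n < N)%N ->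
    (k <= M)%N /\ forall m, (a n.+1 <= b m.+1) = (k <= m)%N by case=> k kP; exists k.
  move=> n; have [nN|] := boolP (n < N)%N; last by exists 0%N.
  have [||k kM kP] := @upward_closed_threshold (fun m => a n.+1 <= b m.+1) M.
  - by move=> m m' mm'; apply/implyP => /le_trans; apply; exact: b_le.
  - by rewrite b_end -a_end a_le// ltnS ltnW.
  by exists k.
have [iota iotaP] : exists iota : nat -> nat, forall m, (m < M)%N ->
    (iota m <= N)%N /\ forall n, (b m.+1 < a n.+1) = (iota m <= n)%N.
  suff /choice : forall m, exists k, (m < M)%N ->
    (k <= N)%N /\ forall n, (b m.+1 < a n.+1) = (k <= n)%N by case=> k kP; exists k.
  move=> m; have [mM|] := boolP (m < M)%N; last by exists 0%N.
  have [||k kN kP] := @upward_closed_threshold (fun n => b m.+1 < a n.+1) N.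
  - by move=> n n' nn'; apply/implyP => /lt_le_trans; apply; exact: a_le.
  - by rewrite a_end -b_end (lt_le_trans (b_incr _))// b_le// ltnS.
  by exists k.
pose u n := \sum_(i < n) (C i (kappa i) (a i.+1) - C i.+1 (kappa i) (a i.+1)).
pose v m := \sum_(i < m) (C (iota i) i.+1 (b i.+1) - C (iota i) i (b i.+1)).
have uS n : u n.+1 = u n + (C n (kappa n) (a n.+1) - C n.+1 (kappa n) (a n.+1)).
  by rewrite /u big_ord_recr.
have vS m : v m.+1 = v m + (C (iota m) m.+1 (b m.+1) - C (iota m) m (b m.+1)).
  by rewrite /v big_ord_recr.
pose V n m s := C n m s + u n - v m.
(* Rows n and n+1 tie in column [kappa n] at time a(n+1). By [row_incr], row n+1 wins at later times
   in that column and beyond, row n at earlier times in that column and before. Columns behave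
   alike. *)
have row_up n m s : (n < N)%N -> (kappa n <= m <= M)%N -> a n.+1 < s -> s <= e ->
    V n.+1 m s < V n m s.
  move=> nN km ans se; rewrite /V uS.
  by have := @row_incr _ _ _ _ _ nN km ans se; lra.
have row_down n m s : (n < N)%N -> (m <= kappa n)%N -> s < a n.+1 ->
    V n m s < V n.+1 m s.
  move=> nN km ans; have [kM _] := kappaP n nN; rewrite /V uS.
  have ae : a n.+1 <= e by rewrite -a_end a_le// ltnS ltnW.
  by have := @row_incr n m (kappa n) _ _ nN ltac:(by rewrite km kM) ans ae; lra.
have col_up n m s : (m < M)%N -> (iota m <= n <= N)%N -> b m.+1 < s -> s <= e ->
    V n m.+1 s < V n m s.
  move=> nN km ans se; rewrite /V vS.
  by have := @col_incr _ _ _ _ _ nN km ans se; lra.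
have col_down n m s : (m < M)%N -> (n <= iota m)%N -> s < b m.+1 ->
    V n m s < V n m.+1 s.
  move=> nN km ans; have [kM _] := iotaP m nN; rewrite /V vS.
  have ae : b m.+1 <= e by rewrite -b_end b_le// ltnS ltnW.
  by have := @col_incr m n (iota m) _ _ nN ltac:(by rewrite km kM) ans ae; lra.
exists u, v => n m s nN mM /andP[ans san] /andP[bms sbm].
have se : s <= e by rewrite -a_end (le_trans (ltW san))// a_le.
have desc n' m' : (n' <= N)%N -> (m' <= M)%N -> (n', m') <> (n, m) ->
    exists n1 m1, [/\ (n1 <= N)%N, (m1 <= M)%N & V n1 m1 s < V n' m' s].
  move=> n'N m'M neq.
  have [n'n|nn'|n'n] := ltngtP n' n.
  - have n'N1 : (n' < N)%N := leq_trans n'n nN.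
    have [_ kP] := kappaP n' n'N1.
    (* Row n' is over. Either row n'+1 is better, or column m' ended before row n' did and column
       m'+1 is better. *)
    have [km|mk] := leqP (kappa n') m'.
      exists n'.+1, m'; split => //; apply: row_up => //; first by rewrite km.
      by rewrite (le_lt_trans _ ans)// a_le.
    have ba : b m'.+1 < a n'.+1 by rewrite ltNge kP -ltnNge.
    have bs : b m'.+1 < s by rewrite (lt_trans ba)// (le_lt_trans _ ans)// a_le.
    have m'M1 : (m' < M)%N by rewrite (leq_trans mk)//; case: (kappaP n' n'N1).
    have [_ iP] := iotaP m' m'M1.
    exists n', m'.+1; split => //; apply: col_up => //.
    by rewrite -iP ba n'N.
  - case: n' n'N nn' neq => // n' n'N nn' neq.
    have [kM kP] := kappaP n' n'N.
    have sa : s < a n'.+1 by rewrite (lt_le_trans san)// a_le.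
    (* The row in question has not begun. Either the preceding row is better, or column m' begins no
       earlier than this row and the preceding column is better. *)
    have [mk|km] := leqP m' (kappa n').
      by exists n', m'; split => //; [exact: ltnW|exact: row_down].
    case: m' m'M km neq => // m' m'M km neq.
    have ab : a n'.+1 <= b m'.+1 by rewrite kP -ltnS.
    have [iN iP] := iotaP m' m'M.
    exists n'.+1, m'; split => //; first exact: ltnW.
    apply: col_down => //; last exact: lt_le_trans ab.
    by rewrite ltnNge -iP -leNgt.
  (* In the active row, comparing the end of the column with the interval of this row tells on which
     side of [iota] the row lies. *)
  subst n'; have [m'm|mm'|mm'] := ltngtP m' m.
  - have m'M1 : (m' < M)%N := leq_trans m'm mM.
    have bs : b m'.+1 < s by rewrite (le_lt_trans _ bms)// b_le.
    have [_ iP] := iotaP m' m'M1.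
    exists n, m'.+1; split => //; apply: col_up => //.
    by rewrite -iP nN andbT (lt_trans bs).
  - case: m' m'M mm' neq => // m' m'M mm' neq.
    have sb : s < b m'.+1 by rewrite (lt_le_trans sbm)// b_le.
    have [iN iP] := iotaP m' m'M.
    exists n, m'; split => //; first exact: ltnW.
    apply: col_down => //; rewrite leqNgt; apply/negP => ilt.
    have : b m'.+1 < a (iota m').+1 by rewrite iP.
    have : a (iota m').+1 <= a n by exact: a_le.
    by lra.
  by case: neq; rewrite mm'.
pose W (p : 'I_N.+1 * 'I_M.+1) := V p.1 p.2 s.
have nN' : (n < N.+1)%N by [].
have mM' : (m < M.+1)%N by [].
have minW : forall q, q != (Ordinal nN', Ordinal mM') ->
    W (Ordinal nN', Ordinal mM') < W q.
  apply: strict_min_of_descent => -[[n' n'N] [m' m'M]] neq.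
  have [||[nn mm]|n1 [m1 [n1N m1M lt1]]] := desc n' m'.
  - by rewrite -ltnS.
  - by rewrite -ltnS.
  - by case/eqP: neq; congr pair; exact/val_inj.
  by exists (Ordinal (n1N : n1 < N.+1)%N, Ordinal (m1M : m1 < M.+1)%N).
move=> n' m' n'N m'M neq.
apply: (minW (Ordinal (n'N : n' < N.+1)%N, Ordinal (m'M : m' < M.+1)%N)).
by apply/eqP => -[] nn mm; apply: neq; rewrite nn mm.
Qed.
End sorting_potentials.

(** * The northwest corner rule *)

(** Defined for every natural index: past the range [inord] returns a genuine index, so for positive
    [r] the partial sums keep increasing strictly, as the breakpoint sequences [a] and [b] must. *)
Definition cumulative (R : realType) (n : nat) (r : 'I_n.+1 -> R) (i : nat) : R :=
  \sum_(i' < i) r (inord i').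

Lemma cumulativeS (R : realType) (n : nat) (r : 'I_n.+1 -> R) (i : nat) :
  cumulative r i.+1 = cumulative r i + r (inord i).
Proof. by rewrite /cumulative big_ord_recr. Qed.

Lemma cumulative_total (R : realType) (n : nat) (r : 'I_n.+1 -> R) :
  cumulative r n.+1 = \sum_i r i.
Proof. by apply: eq_bigr => i _; rewrite inord_val. Qed.

Lemma cumulative_lt (R : realType) (n : nat) (r : 'I_n.+1 -> R) :
  (forall i, 0 < r i) -> forall i j, (i < j)%N -> cumulative r i < cumulative r j.
Proof.
move=> r0; apply: (@homo_ltn _ _ <%R) => [y x z|i]; first exact: lt_trans.
by rewrite cumulativeS ltrDl.
Qed.

Lemma cumulative_le (R : realType) (n : nat) (r : 'I_n.+1 -> R) :
  (forall i, 0 < r i) -> forall i j, (i <= j)%N -> cumulative r i <= cumulative r j.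
Proof.
move=> r0 i j; rewrite leq_eqVlt => /orP[/eqP->//|ij].
exact/ltW/cumulative_lt.
Qed.

Section northwest_corner.
Variables (R : realType) (J K : nat).
Variables (supply : 'I_J.+1 -> R) (demand : 'I_K.+1 -> R) (Q : R).
Hypotheses (supply_gt0 : forall j, 0 < supply j).
Hypotheses (demand_gt0 : forall k, 0 < demand k).
Hypotheses (supply_sum : \sum_j supply j = Q) (demand_sum : \sum_k demand k = Q).

Let A := cumulative supply.
Let B := cumulative demand.
Let G (i : nat) := \sum_(i' < i) group_mass supply demand i'.

(** The rule merges the partitions of [0, Q] with breakpoints [A] and [B]: the allocated mass [G i]
    lies in the half-open cells of the current location and job. The last field bounds the number of
    steps. *)
Record nwc_invariant (i : nat) (st : nwc_state R J K) : Prop := {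
  nwc_supply_later : forall j : 'I_J.+1, (nwc_loc st < j)%N -> nwc_supply st j = supply j ;
  nwc_demand_later : forall k : 'I_K.+1, (nwc_job st < k)%N -> nwc_demand st k = demand k ;
  nwc_supply_now : nwc_supply st (nwc_loc st) = A (nwc_loc st).+1 - G i ;
  nwc_demand_now : nwc_demand st (nwc_job st) = B (nwc_job st).+1 - G i ;
  nwc_loc_bounds : A (nwc_loc st) <= G i < A (nwc_loc st).+1 ;
  nwc_job_bounds : B (nwc_job st) <= G i < B (nwc_job st).+1 ;
  nwc_progress : (i <= nwc_loc st + nwc_job st)%N }.

Let GS i : G i.+1 = G i + nwc_mass (nwc_run supply demand i).
Proof. by rewrite /G big_ord_recr. Qed.

(** What remains at the current location and job is the distance from [G i] to their next
    breakpoints, so the allocation advances to the nearer one. *)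
Let mass_min i (st := nwc_run supply demand i) : nwc_invariant i st ->
  G i.+1 = Num.min (A (nwc_loc st).+1) (B (nwc_job st).+1).
Proof.
move=> inv; rewrite GS /nwc_mass (nwc_supply_now inv) (nwc_demand_now inv).
by rewrite -addr_minl addrC subrK.
Qed.

(* One coordinate of a step: the quantity [r] at index [n] is lowered by the
   group mass and the index moves on exactly when the quantity is used up. *)
Let nwc_advance L (r0 r : 'I_L.+1 -> R) (n : 'I_L.+1) (S S' : R)
    (r' := fun k => r k - (if k == n then S' - S else 0))
    (n' := if r' n == 0 then inord n.+1 else n) :
  (forall k, 0 < r0 k) ->
  (forall k : 'I_L.+1, (n < k)%N -> r k = r0 k) ->
  r n = cumulative r0 n.+1 - S ->
  cumulative r0 n <= S -> S <= S' -> S' <= cumulative r0 n.+1 ->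
  S' < \sum_k r0 k ->
  [/\ forall k : 'I_L.+1, (n' < k)%N -> r' k = r0 k,
      r' n' = cumulative r0 n'.+1 - S',
      cumulative r0 n' <= S' < cumulative r0 n'.+1,
      (n <= n')%N & S' = cumulative r0 n.+1 -> (n < n')%N].
Proof.
move=> r0_gt0 later now nS SS' S'n S'Q.
have r'n : r' n = cumulative r0 n.+1 - S' by rewrite /r' eqxx now; lra.
have r'k (k : 'I_L.+1) : (n < k)%N -> r' k = r0 k.
  by move=> nk; rewrite /r' ifF ?subr0 ?later//; apply: contraTF nk => /eqP->; rewrite ltnn.
rewrite /n' r'n; case: eqP => [e|ne]; last first.
  split => //; last by move=> e; case: ne; rewrite e subrr.
  by rewrite (le_trans nS SS')/= lt_neqAle S'n andbT; apply/eqP => e; apply: ne; rewrite e subrr.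
have {}e : S' = cumulative r0 n.+1 by lra.
(* Exhausting the last index would mean that the whole mass is allocated, against [S'Q]; hence
   [inord] does not wrap here. *)
have nL : (n.+1 < L.+1)%N.
  rewrite ltnNge; apply/negP => Ln.
  move: S'Q; rewrite e -cumulative_total ltNge => /negP; apply.
  exact: cumulative_le.
have vn : (inord n.+1 : 'I_L.+1) = n.+1 :> nat by rewrite inordK.
split => //.
- by move=> k; rewrite vn => /ltnW; exact: r'k.
- by rewrite r'k vn// cumulativeS -e addrAC subrr add0r.
- by rewrite vn e lexx/= cumulative_lt.
- by rewrite vn.
- by rewrite vn.
Qed.

(** As long as some mass is left, neither index can run past its last value, and each coordinate is
    updated by [nwc_advance]. *)
Let nwc_run_invariant i : (forall i', (i' <= i)%N -> G i' < Q) ->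
  nwc_invariant i (nwc_run supply demand i).
Proof.
elim: i => [|i IHi] GQ.
  have A1 : A 1 = supply ord0.
    by rewrite /A /cumulative big_ord1; congr supply; apply/val_inj; rewrite /= inordK.
  have B1 : B 1 = demand ord0.
    by rewrite /B /cumulative big_ord1; congr demand; apply/val_inj; rewrite /= inordK.
  split; rewrite //= /G ?big_ord0 ?subr0 ?A1 ?B1//.
  - by rewrite /A /cumulative big_ord0 lexx supply_gt0.
  - by rewrite /B /cumulative big_ord0 lexx demand_gt0.
have {IHi} inv := IHi (fun i' i'i => GQ i' (leqW i'i)).
have Gmin := mass_min inv.
have GSQ := GQ i.+1 (leqnn _).
case: inv; set st := nwc_run supply demand i.
move=> sl dl sn dn /andP[al au] /andP[bl bu] prog.
have massE : nwc_mass st = G i.+1 - G i by rewrite GS addrC addKr.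
have GG : G i <= G i.+1 by rewrite Gmin le_min !ltW.
have GA : G i.+1 <= A (nwc_loc st).+1 by rewrite Gmin ge_min lexx.
have GB : G i.+1 <= B (nwc_job st).+1 by rewrite Gmin ge_min lexx orbT.
have [] := nwc_advance supply_gt0 sl sn al GG GA; first by rewrite supply_sum.
have [] := nwc_advance demand_gt0 dl dn bl GG GB; first by rewrite demand_sum.
rewrite -!massE => l1 n1 b1 p1 q1 l2 n2 b2 p2 q2.
split => //.
(* The minimum is attained at one of the two breakpoints, and the corresponding index moves on. *)
have /orP[/eqP e|/eqP e] : (G i.+1 == A (nwc_loc st).+1) || (G i.+1 == B (nwc_job st).+1).
- by rewrite Gmin; case: leP; rewrite eqxx ?orbT.
- by rewrite (leq_ltn_trans prog)// -addSn leq_add// q2.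
- by rewrite (leq_ltn_trans prog)// -addnS leq_add// q1.
Qed.

(** The groups are the cells of the common refinement of the two partitions, [I] being the first
    index at which the allocated mass reaches [Q]. *)
Lemma nwc_groups : exists I : nat, nwc_stops supply demand Q I /\
  forall i (j := group_loc supply demand i) (k := group_job supply demand i),
    (i < I)%N ->
    [/\ A j <= G i, B k <= G i, G i < G i.+1 &
        G i.+1 = Num.min (A j.+1) (B k.+1)].
Proof.
(* Otherwise the indices would add up to at least J + K + 1 at that step, while their sum never
   exceeds J + K. *)
have exI : exists i, Q <= G i.
  apply: contrapT => nex.
  have GQ i : G i < Q by rewrite ltNge; apply/negP => QG; apply: nex; exists i.
  have := nwc_progress (nwc_run_invariant (fun i (_ : (i <= (J + K).+1)%N) => GQ i)).
  by rewrite leqNgt ltnS leq_add// -ltnS.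
case: (ex_minnP exI) => I QG Imin.
have GQ i : (i < I)%N -> G i < Q.
  by move=> iI; rewrite ltNge; apply/negP => /Imin; rewrite leqNgt iI.
have inv i : (i < I)%N -> nwc_invariant i (nwc_run supply demand i).
  by move=> iI; apply: nwc_run_invariant => i' /leq_ltn_trans/(_ iI)/GQ.
have Q_gt0 : 0 < Q.
  rewrite -supply_sum -cumulative_total; apply: le_lt_trans (cumulative_lt supply_gt0 (ltn0Sn J)).
  by rewrite /cumulative big_ord0.
have I_gt0 : (0 < I)%N.
  by rewrite lt0n; apply/eqP => I0; move: QG; rewrite I0 /G big_ord0 leNgt Q_gt0.
exists I; split.
  split => //; last by move=> n /andP[_ /GQ nQ] e; move: nQ; rewrite /G e ltxx.
  (* No overshoot: the last allocation stops at a breakpoint of [A], or earlier, and these do not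
     exceed [Q]. *)
  apply/eqP; rewrite eq_le [X in _ && X]QG andbT.
  case: I I_gt0 {QG Imin GQ} inv => // I _ inv.
  rewrite -/(G I.+1) (mass_min (inv I (leqnn _))) ge_min -supply_sum -cumulative_total.
  by rewrite cumulative_le.
move=> i j k iI; have ii := inv i iI.
have /andP[al au] := nwc_loc_bounds ii; have /andP[bl bu] := nwc_job_bounds ii.
split => //; last exact: mass_min.
by rewrite (mass_min ii) lt_min au.
Qed.

End northwest_corner.

(** * Integration lemmas *)

Section measure_lemmas.
Context d (T : measurableType d) (R : realType).
Variable mu : {measure set T -> \bar R}.
Local Open Scope ereal_scope.

(** The negative part is dominated by |G| and so has a finite integral; an integral below +oo then
    bounds the positive part too. *)
Lemma integrable_bounded_below (D : set T) (F G : T -> \bar R) :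
  measurable D -> measurable_fun D F -> mu.-integrable D G ->
  (forall t, D t -> - G t <= F t) -> \int[mu]_(t in D) F t < +oo ->
  mu.-integrable D F.
Proof.
move=> mD mF iG GF Foo.
have mFp : measurable_fun D F^\+ by exact: measurable_funepos.
have mFn : measurable_fun D F^\- by exact: measurable_funeneg.
have Fn_lty : \int[mu]_(t in D) F^\- t < +oo.
  case/integrableP: iG => mG; apply: le_lt_trans.
  apply: ge0_le_integral => //; first exact: measurableT_comp.
  move=> t Dt; rewrite funenegE; have := GF t Dt.
  rewrite ge_max abse_ge0 andbT leeNl => /le_trans; apply.
  exact: lee_abs.
have Fn_fin : \int[mu]_(t in D) F^\- t \is a fin_num.
  by rewrite ge0_fin_numE// integral_ge0.
have Fp_lty : \int[mu]_(t in D) F^\+ t < +oo.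
  move: Foo; rewrite integralE.
  by rewrite lteBlDr// -(fineK Fn_fin).
apply/integrableP; split => //.
rewrite (_ : (fun t => `|F t|) = F^\+ \+ F^\-); last exact: fune_abse.
by rewrite ge0_integralD// lte_add_pinfty.
Qed.

(** Almost everywhere h = |h|, so the integral of |h| is at most 0. *)
Lemma ae_ge0_integral_le0 (D : set T) (h : T -> \bar R) :
  measurable D -> mu.-integrable D h ->
  {ae mu, forall t, D t -> 0 <= h t} -> \int[mu]_(t in D) h t <= 0 ->
  {ae mu, forall t, D t -> h t = 0}.
Proof.
move=> mD ih h0 hle; have mh := measurable_int mu ih.
have : ae_eq mu D h (cst 0).
  apply/(ae_eq_integral_abs mu mD mh)/eqP; rewrite eq_le integral_ge0// andbT.
  rewrite (ae_eq_integral h)//; first exact: measurableT_comp.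
  by apply: filterS h0 => t h0 /h0/gee0_abs.
by [].
Qed.

Lemma ae_forall_fin (I : finType) (P : I -> T -> Prop) :
  (forall i, {ae mu, forall t, P i t}) -> {ae mu, forall t, forall i, P i t}.
Proof. by move=> HP; apply: filter_forall. Qed.

Lemma ae_imply (P P' : T -> Prop) : (forall t, P t -> P' t) ->
  {ae mu, forall t, P t} -> {ae mu, forall t, P' t}.
Proof. by move=> PP'; apply: filterS. Qed.

Lemma ae_and (P P' : T -> Prop) : {ae mu, forall t, P t} ->
  {ae mu, forall t, P' t} -> {ae mu, forall t, P t /\ P' t}.
Proof. by apply: filterS2. Qed.
End measure_lemmas.

(** * Reduced costs *)

(** The excess over h(p) mu is the sum of the (h(i) - h(p)) x(i) plus h(p) (sum of x - mu). Both
    parts are nonnegative; if they vanish, [x] is concentrated at [p] and exhausts the capacity. *)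
Lemma greedy_linear_bound (R : realFieldType) (I : finType) (h x : I -> R)
    (mu : R) (p : I) :
  (forall i, 0 <= x i) -> \sum_i x i <= mu -> h p < 0 ->
  (forall q, q != p -> h p < h q) ->
  h p * mu <= \sum_i h i * x i /\
  (\sum_i h i * x i = h p * mu ->
   x p = mu /\ forall q, q != p -> x q = 0).
Proof.
move=> x0 xmu hp hmin.
have gap_ge0 i : 0 <= (h i - h p) * x i.
  apply: mulr_ge0 => //; rewrite subr_ge0.
  by have [->|/hmin/ltW] := eqVneq i p.
have gapE : \sum_i h i * x i =
    \sum_i (h i - h p) * x i + h p * \sum_i x i.
  rewrite mulr_sumr -big_split; apply: eq_bigr => i _ /=.
  by rewrite -mulrDl subrK.
have gaps_ge0 : 0 <= \sum_i (h i - h p) * x i by apply: sumr_ge0.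
have slack_ge0 : h p * mu <= h p * \sum_i x i by rewrite ler_nM2l.
split; first by rewrite gapE; lra.
rewrite gapE => e.
have x_other q : q != p -> x q = 0.
  move=> qp; have gap0 : \sum_i (h i - h p) * x i = 0 by lra.
  move/eqP: gap0; rewrite psumr_eq0// => /allP/(_ q).
  rewrite mem_index_enum => /(_ isT)/=.
  by rewrite mulf_eq0 subr_eq0 (gt_eqF (hmin q qp)) => /eqP.
split => //.
have : h p * \sum_i x i = h p * mu by lra.
move/(mulfI (ltr0_neq0 hp)); rewrite (bigD1 p)//= big1 ?addr0//.
Qed.

Section reduced_cost.
Context {R : realType} {J K : nat}.
Variables (S : set R) (mu Q : R) (supply : 'I_J.+1 -> R) (demand : 'I_K.+1 -> R).
Variable c : 'I_J.+1 -> 'I_K.+1 -> R -> \bar R.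
Hypothesis mS : @measurable _ (measurableTypeR R) S.
Hypotheses (supply_sum : \sum_j supply j = Q) (demand_sum : \sum_k demand k = Q).

Notation lambda := (@lebesgue_measure R).

Variable x : 'I_J.+1 -> 'I_K.+1 -> R -> R.
Hypothesis x_feas : feasible S mu supply demand x.

Let mx j k : measurable_fun S (EFin \o x j k).
Proof. by apply/measurable_EFinP; exact: (flow_measurable x_feas j k). Qed.

Lemma flow_integrable j k : lambda.-integrable S (EFin \o x j k).
Proof.
apply/integrableP; split; first exact: mx.
have x0 k' s : S s -> (0 <= (x j k' s)%:E)%E.
  by move=> Ss; rewrite lee_fin (flow_ge0 x_feas).
apply: (@le_lt_trans _ _ (\int[lambda]_(s in S) (x j k s)%:E)%E).
  by rewrite le_eqVlt; apply/orP; left; apply/eqP; apply: eq_integral => s;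
    rewrite inE => Ss; rewrite gee0_abs// x0.
apply: le_lt_trans (ltry (supply j)).
apply: le_trans (flow_supply x_feas j).
rewrite [leRHS](bigD1 k)//= leeDl// sume_ge0// => k' _.
by apply: integral_ge0 => s; exact: x0.
Qed.

Definition flow_mass j k : R := fine (\int[lambda]_(s in S) (x j k s)%:E).

Lemma flow_massE j k :
  (\int[lambda]_(s in S) (x j k s)%:E = (flow_mass j k)%:E)%E.
Proof.
by rewrite /flow_mass fineK//; apply: integrable_fin_num (flow_integrable j k).
Qed.

(* Both constraints bound the same total by Q, from opposite sides. *)
Lemma flow_marginals :
  (forall j, \sum_k flow_mass j k = supply j) /\
  (forall k, \sum_j flow_mass j k = demand k).
Proof.
have sl j : \sum_k flow_mass j k <= supply j.
  rewrite -lee_fin -sumEFin; apply: le_trans (flow_supply x_feas j).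
  by under eq_bigr do rewrite -flow_massE.
have dl k : demand k <= \sum_j flow_mass j k.
  rewrite -lee_fin -sumEFin; apply: le_trans (flow_demand x_feas k) _.
  by under [leRHS]eq_bigr do rewrite -flow_massE.
have sQ : \sum_j \sum_k flow_mass j k <= Q by rewrite -supply_sum ler_sum.
have Qs : Q <= \sum_j \sum_k flow_mass j k.
  by rewrite exchange_big/= -demand_sum ler_sum.
split.
(* Nonnegative slacks with sum zero all vanish. *)
- have /eqP : \sum_j (supply j - \sum_k flow_mass j k) = 0.
    by rewrite sumrB supply_sum; lra.
  rewrite psumr_eq0 => [|j _]; last by rewrite subr_ge0.
  move=> /allP H j; have := H j; rewrite mem_index_enum => /(_ isT)/=.
  by rewrite subr_eq0 => /eqP.
- have /eqP : \sum_k (\sum_j flow_mass j k - demand k) = 0.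
    by rewrite sumrB demand_sum exchange_big/=; lra.
  rewrite psumr_eq0 => [|j _]; last by rewrite subr_ge0.
  move=> /allP H j; have := H j; rewrite mem_index_enum => /(_ isT)/=.
  by rewrite subr_eq0 => /eqP.
Qed.

Hypothesis mc : forall j k, measurable_fun S (c j k).
Variable c0 : R.
Hypothesis c_ge : forall j k s, S s -> (c0%:E <= c j k s)%E.
Hypothesis x_cost : (total_cost S c x < +oo)%E.

Let cx j k (s : R) : \bar R := (c j k s * (x j k s)%:E)%E.

Let mcx j k : measurable_fun S (cx j k).
Proof. exact: (emeasurable_funM (mc j k) (mx j k)). Qed.

Let cx_integrable_lty j k :
  (\int[lambda]_(s in S) cx j k s < +oo)%E -> lambda.-integrable S (cx j k).
Proof.
move=> clt; apply: (@integrable_bounded_below _ (measurableTypeR R) R lambda S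
  (cx j k) (fun s => (- c0)%:E * (x j k s)%:E)%E).
- exact: mS.
- exact: mcx.
- exact: (integrableZl mS (- c0) (flow_integrable j k)).
- move=> s Ss; rewrite EFinN mulNe oppeK /cx.
  by apply: lee_wpmul2r; [rewrite lee_fin (flow_ge0 x_feas)|exact: c_ge].
- exact: clt.
Qed.

(** A sum below +oo could hide a term +oo behind a term -oo. The latter is excluded first: each term
    is either finite, by integrability, or +oo. *)
Lemma flow_cost_integrable j k :
  lambda.-integrable S (fun s => c j k s * (x j k s)%:E)%E.
Proof.
apply: cx_integrable_lty; rewrite ltNge leye_eq; apply/negP => /eqP cy.
have ngt j' k' : (\int[lambda]_(s in S) cx j' k' s != -oo)%E.
  have [/cx_integrable_lty|] := boolP (\int[lambda]_(s in S) cx j' k' s < +oo)%E.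
    by move=> /integrable_fin_num -/(_ mS); rewrite fin_numE => /andP[].
  by rewrite -leNgt leye_eq => /eqP->.
move: x_cost; rewrite /total_cost.
have -> : (\sum_(j < J.+1) \sum_(k < K.+1)
     \int[lebesgue_measure]_(s in S) (c j k s * (x j k s)%:E) = +oo)%E.
  have row_ngt j' : (\sum_(k < K.+1) \int[lambda]_(s in S) cx j' k s != -oo)%E.
    by apply/eqP => /esum_eqNyP [k' [_ _ e]]; have := ngt j' k'; rewrite e.
  apply: (iffRL (esum_eqyP _ (fun j' _ => row_ngt j'))).
  exists j; rewrite mem_index_enum; split => //.
  apply: (iffRL (esum_eqyP _ (fun k' _ => ngt j k'))).
  by exists k; rewrite mem_index_enum.
by rewrite ltxx.
Qed.

Lemma flow_cost_fin_num : {ae lambda, forall s, S s ->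
  forall j k, (c j k s * (x j k s)%:E)%E \is a fin_num}.
Proof.
have H j k : {ae lambda, forall s, S s ->
    (c j k s * (x j k s)%:E)%E \is a fin_num}.
  exact: (integrable_ae mS (flow_cost_integrable j k)).
have : {ae lambda, forall s, forall j k, S s ->
    (c j k s * (x j k s)%:E)%E \is a fin_num}.
  by apply: ae_forall_fin => j; apply: ae_forall_fin => k; exact: H.
by apply: ae_imply => s H' Ss j k; exact: H'.
Qed.

(** If y = +oo, finiteness of the product forces r = 0, and both sides are 0. *)
Lemma fineM_fin_num (y : \bar R) (r : R) : y != -oo%E ->
  (y * r%:E)%E \is a fin_num -> ((fine y * r)%:E = y * r%:E)%E.
Proof.
case: y => [y| |]//= _.
have [r0|r0|->] := ltgtP r 0; last by rewrite mule0 mulr0.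
  by rewrite lt0_mulye.
by rewrite gt0_mulye.
Qed.

Let c_neqNy j k s : S s -> c j k s != -oo%E.
Proof. by move=> /(c_ge j k); apply: contraTneq => ->. Qed.

(** A flow of finite cost vanishes almost everywhere where the cost is +oo, so real-valued costs may
    be used under the integral. *)
Let fine_cost j k :
  lambda.-integrable S (fun s => (fine (c j k s) * x j k s)%:E) /\
  (\int[lambda]_(s in S) (fine (c j k s) * x j k s)%:E =
   \int[lambda]_(s in S) cx j k s)%E.
Proof.
have mf : measurable_fun S (fun s => (fine (c j k s) * x j k s)%:E).
  apply/measurable_EFinP; apply: measurable_funM.
    apply: (@measurable_comp _ _ _ _ _ _ setT) => //; exact: fine_measurable.
  exact: (flow_measurable x_feas).
have ae : ae_eq lambda S (cx j k) (fun s => (fine (c j k s) * x j k s)%:E).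
  apply: ae_imply flow_cost_fin_num => s H Ss.
  by rewrite fineM_fin_num//; [exact: c_neqNy|exact: H].
split.
  apply: (le_integrable mS mf _ (flow_cost_integrable j k)) => s Ss.
  have := c_neqNy j k Ss; case: (c j k s) => [y| |]//= _.
  by rewrite mul0r normr0 abse_ge0.
by apply/esym/ae_eq_integral => //; exact: mcx.
Qed.

(** The dual terms integrate to the marginals of the flow, which are tight by [flow_marginals]; the
    added constant is therefore the same for all such flows. *)
Lemma reduced_cost_integral (u : 'I_J.+1 -> R) (v : 'I_K.+1 -> R) (w : R) :
  let H s := \sum_j \sum_k (fine (c j k s) + u j - v k - w) * x j k s in
  lambda.-integrable S (EFin \o H) /\
  (\int[lambda]_(s in S) (H s)%:E = total_cost S c x +
    (\sum_j u j * supply j - \sum_k v k * demand k - w * Q)%:E)%E.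
Proof.
move=> H.
pose h j k s := ((fine (c j k s) * x j k s)%:E + (u j - v k - w)%:E * (x j k s)%:E)%E.
have HE s : (H s)%:E = (\sum_j \sum_k h j k s)%E.
  rewrite /H -sumEFin; apply: eq_bigr => j _; rewrite -sumEFin; apply: eq_bigr => k _.
  by rewrite /h -EFinM -EFinD; congr EFin; ring.
have ih j k : lambda.-integrable S (h j k).
  apply: (integrableD mS (fine_cost j k).1).
  exact: (integrableZl mS _ (flow_integrable j k)).
have inth j k : (\int[lambda]_(s in S) h j k s =
    \int[lambda]_(s in S) cx j k s + ((u j - v k - w) * flow_mass j k)%:E)%E.
  rewrite (integralD mS (fine_cost j k).1 (integrableZl mS _ (flow_integrable j k))).
  rewrite (fine_cost j k).2; congr (_ + _)%E.
  by rewrite (integralZl mS (flow_integrable j k)) flow_massE EFinM.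
have ih1 j : lambda.-integrable S (fun s => \sum_k h j k s)%E.
  exact: (integrable_sum mS).
split.
  rewrite (_ : EFin \o H = fun s => \sum_j \sum_k h j k s)%E; last exact/funext.
  exact: (integrable_sum mS).
under eq_integral do rewrite HE.
rewrite (integral_sum mS)//.
under eq_bigr => j _.
  rewrite (integral_sum mS)//; under eq_bigr do rewrite inth.
  rewrite big_split/=; over.
rewrite big_split/=; congr (_ + _)%E.
under eq_bigr do rewrite sumEFin.
rewrite sumEFin; congr EFin.
have [rs cs] := flow_marginals.
have -> : w * Q = \sum_j \sum_k w * flow_mass j k.
  by rewrite -supply_sum mulr_sumr; apply: eq_bigr => j _; rewrite -mulr_sumr rs.
have -> : \sum_k v k * demand k = \sum_j \sum_k v k * flow_mass j k.
  by rewrite exchange_big/=; apply: eq_bigr => k _; rewrite -mulr_sumr cs.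
rewrite -!sumrB; apply: eq_bigr => j _.
rewrite -rs mulr_sumr -!sumrB; apply: eq_bigr => k _; ring.
Qed.
End reduced_cost.

(** * The sorted flow *)

(** Written as a difference of two step functions, so that sums over adjacent intervals
    telescope. *)
Lemma indic_itv_oc (R : realType) (p q s : R) : p <= q ->
  \1_`]p, q] s = (p < s)%R%:R - (q < s)%R%:R :> R.
Proof.
move=> pq; rewrite indicE mem_setE in_itv/= [s <= q]leNgt.
case: (ltP q s) => [qs|sq]; first by rewrite (le_lt_trans pq qs) subrr.
by rewrite andbT subr0.
Qed.

Section block_flow.
Context {R : realType}.
Notation lambda := (@lebesgue_measure R).

Lemma sum_indic_itv_oc (b : nat -> R) (n : nat) (s : R) :
  (forall i j, (i <= j)%N -> b i <= b j) ->
  \sum_(i < n) \1_`]b i, b i.+1] s = \1_`]b 0, b n] s :> R.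
Proof.
move=> b_le; rewrite indic_itv_oc ?b_le//.
under eq_bigr => i _ do rewrite indic_itv_oc ?b_le// -opprB.
rewrite sumrN -(big_mkord xpredT (fun i => (b i.+1 < s)%R%:R - (b i < s)%R%:R)).
by rewrite telescope_sumr// opprB.
Qed.

(** The sorted flow: type (n, m) uses the full capacity while the interval of row n overlaps that of
    column m. Half-open intervals tile without double counting. *)
Definition block_flow (mu : R) (a b : nat -> R) (n m : nat) (s : R) : R :=
  mu * (\1_`]a n, a n.+1] s * \1_`]b m, b m.+1] s).

Lemma block_flow_ge0 mu a b n m s : 0 <= mu -> 0 <= block_flow mu a b n m s.
Proof. by move=> mu0; rewrite /block_flow !mulr_ge0. Qed.

Lemma block_flowC mu a b n m s :
  block_flow mu a b n m s = block_flow mu b a m n s.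
Proof. by rewrite /block_flow [X in mu * X]mulrC. Qed.

Lemma measurable_block_flow (S : set R) mu a b n m :
  measurable_fun S (block_flow mu a b n m).
Proof.
apply: measurable_funM => //; apply: measurable_funM.
  by apply: measurable_indic; exact: measurable_itv.
by apply: measurable_indic; exact: measurable_itv.
Qed.

(** The column intervals tile a set containing the interval of row n, so their indicators add up to
    1 there. *)
Lemma sum_block_flow mu a b N n s :
  (forall i j, (i <= j)%N -> b i <= b j) ->
  b 0 <= a n -> a n.+1 <= b N ->
  \sum_(m < N) block_flow mu a b n m s = mu * \1_`]a n, a n.+1] s.
Proof.
move=> b_le ba ab; rewrite /block_flow -mulr_sumr -mulr_sumr sum_indic_itv_oc//.
congr (mu * _); rewrite !indicE !mem_setE !in_itv/=.
case: (ltP (a n) s) => [ans|]; last by rewrite mul0r.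
case: (leP s (a n.+1)) => [san|]; last by rewrite mul0r.
by rewrite (le_lt_trans ba ans) (le_trans san ab) mulr1.
Qed.

Lemma integral_sum_block_flow (S : set R) mu a b N n :
  @measurable _ (measurableTypeR R) S -> 0 <= mu ->
  (forall i j, (i <= j)%N -> b i <= b j) -> a n <= a n.+1 ->
  b 0 <= a n -> a n.+1 <= b N -> `]a n, a n.+1]%classic `<=` S ->
  (\sum_(m < N) \int[lambda]_(s in S) (block_flow mu a b n m s)%:E =
   (mu * (a n.+1 - a n))%:E)%E.
Proof.
move=> mS mu0 b_le an ba ab aS.
rewrite -(ge0_integral_sum lambda mS); last 2 first.
- by move=> m; apply/measurable_EFinP; exact: measurable_block_flow.
- by move=> m s _; rewrite lee_fin block_flow_ge0.
under eq_integral do rewrite sumEFin sum_block_flow// EFinM.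
rewrite (ge0_integralZl lambda mS); last 3 first.
- by apply/measurable_EFinP; apply: measurable_indic; exact: measurable_itv.
- by move=> s _; rewrite lee_fin.
- by rewrite lee_fin.
rewrite (integral_indic lambda mS); last exact: measurable_itv.
have lam : lambda `]a n, a n.+1]%classic = (a n.+1 - a n)%:E.
  rewrite lebesgue_measure_itv/= lte_fin; case: ltP => [_|aa]; first by rewrite -EFinB.
  have -> : a n.+1 = a n by apply/eqP; rewrite eq_le aa an.
  by rewrite subrr.
by rewrite [X in (_ * lambda X)%E](setIidl aS) lam.
Qed.

End block_flow.

(** * Optimal flows are sorted *)

Lemma ae_neq_point (R : realType) (p : R) :
  {ae (@lebesgue_measure R), forall s, s <> p}.
Proof.
exists [set p]; split; [exact: measurable_set1|exact: lebesgue_measure_set1|].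
by move=> s /= /contrapT.
Qed.

Lemma interval_cover (R : realType) (a : nat -> R) (N : nat) (s : R) :
  (forall i j, (i <= j)%N -> a i <= a j) -> a 0 < s < a N.+1 ->
  (forall i, (i < N.+2)%N -> s <> a i) ->
  exists2 n, (n < N.+1)%N & a n < s < a n.+1.
Proof.
move=> a_le /andP[a0s saN] sa.
have [||k kN kP] := @upward_closed_threshold (fun n => s < a n.+1) N => //.
  by move=> m m' mm'; apply/implyP => /lt_le_trans; apply; exact: a_le.
exists k => //; rewrite kP leqnn andbT; case: k kN kP => // k kN kP.
rewrite lt_neqAle leNgt kP ltnn andbT eq_sym; apply/eqP; apply: sa.
by rewrite ltnS ltnW// ltnS ltnW.
Qed.

Section sorted_equilibrium.
Context {R : realType} {J K : nat}.
Notation lambda := (@lebesgue_measure R).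
Variables (S : set R) (mu Q : R) (supply : 'I_J.+1 -> R) (demand : 'I_K.+1 -> R).
Variables (C : 'I_J.+1 -> 'I_K.+1 -> R -> R) (a b : nat -> R) (c0 : R).
Hypothesis mS : @measurable _ (measurableTypeR R) S.
Hypothesis mu_gt0 : 0 < mu.
Hypotheses (supply_sum : \sum_j supply j = Q) (demand_sum : \sum_k demand k = Q).
Hypotheses (a_incr : forall n, a n < a n.+1) (b_incr : forall m, b m < b m.+1).
Hypotheses (ab_start : a 0 = b 0) (a_end : a J.+1 = 0) (b_end : b K.+1 = 0).
Hypothesis supplyE : forall j : 'I_J.+1, supply j = mu * (a j.+1 - a j).
Hypothesis demandE : forall k : 'I_K.+1, demand k = mu * (b k.+1 - b k).
Hypothesis S_long : [set s : R | a 0 <= s <= 0] `<=` S.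

Let c j k (s : R) : \bar R := if s <= 0 then (C j k s)%:E else +oo%E.

Hypothesis mc : forall j k, measurable_fun S (c j k).
Hypothesis C_decr : forall j k (s s' : R), s < s' -> s' <= 0 -> C j k s' < C j k s.
Hypothesis C_ge : forall j k (s : R), s <= 0 -> c0 <= C j k s.

Variables (u : 'I_J.+1 -> R) (v : 'I_K.+1 -> R).
Let V j k s := C j k s + u j - v k.
Hypothesis V_min : forall (j : 'I_J.+1) (k : 'I_K.+1) s,
  a j < s < a j.+1 -> b k < s < b k.+1 ->
  forall j' k', (j', k') <> (j, k) -> V j k s < V j' k' s.

Let a_le := increasing_le a_incr.

Let b_le := increasing_le b_incr.

Let y (j : 'I_J.+1) (k : 'I_K.+1) : R -> R := block_flow mu a b j k.

Lemma block_flow_feasible : feasible S mu supply demand y.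
Proof.
have mu0 := ltW mu_gt0.
have aS (j : 'I_J.+1) : `]a j, a j.+1]%classic `<=` S.
  move=> s /=; rewrite in_itv/= => /andP[ajs saj]; apply: S_long => /=.
  by rewrite (le_trans (a_le _) (ltW ajs))//= (le_trans saj)// -a_end a_le.
have bS (k : 'I_K.+1) : `]b k, b k.+1]%classic `<=` S.
  move=> s /=; rewrite in_itv/= => /andP[ajs saj]; apply: S_long => /=.
  by rewrite ab_start (le_trans (b_le _) (ltW ajs))//= (le_trans saj)// -b_end b_le.
split.
- by move=> j k; exact: measurable_block_flow.
- by move=> j k s _; exact: block_flow_ge0.
- apply/aeW => s _.
  under eq_bigr => j _.
    rewrite sum_block_flow//; first over.
    - by rewrite -ab_start a_le.
    - by rewrite b_end -a_end a_le.
  rewrite -mulr_sumr (sum_indic_itv_oc _ _ a_le) -[leRHS]mulr1.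
  apply: ler_wpM2l => //; by rewrite indicE lern1 leq_b1.
- move=> j; rewrite (integral_sum_block_flow mS mu0 b_le)//.
  + by rewrite supplyE.
  + exact: ltW.
  + by rewrite -ab_start a_le.
  + by rewrite b_end -a_end a_le.
- move=> k; rewrite /y.
  (* Column sums are row sums with [a] and [b] exchanged. *)
  under eq_bigr do under eq_integral do rewrite block_flowC.
  rewrite (integral_sum_block_flow mS mu0 a_le)//.
  + by rewrite demandE.
  + exact: ltW.
  + by rewrite ab_start b_le.
  + by rewrite a_end -b_end b_le.
Qed.

Let y_out (j : 'I_J.+1) (k : 'I_K.+1) (s : R) :
  ~~ (a j < s <= a j.+1) \/ ~~ (b k < s <= b k.+1) -> y j k s = 0.
Proof.
rewrite /y /block_flow !indicE !mem_setE !in_itv/=.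
by case=> /negbTE->; rewrite ?mul0r ?mulr0 ?mul0r.
Qed.

Lemma block_flow_cost_lty : (total_cost S c y < +oo)%E.
Proof.
apply/lte_sum_pinfty => j _; apply/lte_sum_pinfty => k _.
(* On the support of the flow the cost lies between [c0] and its value at [a 0], because it
   decreases in time. *)
pose M := `|C j k (a 0)| + `|c0|.
have icy : lambda.-integrable S (fun s => c j k s * (y j k s)%:E)%E.
  have iy := flow_integrable block_flow_feasible j k.
  apply: (le_integrable mS _ _ (integrableZl mS M iy)).
    apply: emeasurable_funM; first exact: mc.
    by apply/measurable_EFinP; exact: measurable_block_flow.
  move=> s Ss /=.
  have [/andP[ajs saj]|out] := boolP (a j < s <= a j.+1); last first.
    have -> : y j k s = 0 by apply: y_out; left.
    by rewrite mule0 abse0 lee_fin.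
  have s0 : s <= 0 by rewrite (le_trans saj)// -a_end a_le.
  have a0s : a 0 < s by rewrite (le_lt_trans _ ajs)// a_le.
  rewrite /c s0 /= lee_fin !normrM ler_wpM2r//.
  have h1 := C_ge j k s0; have h2 := C_decr j k a0s s0.
  rewrite [leRHS]ger0_norm ?addr_ge0// ler_norml.
  have := ler_norm (C j k (a 0)); have := ler_norm (- c0); rewrite normrN.
  have := normr_ge0 c0; have := normr_ge0 (C j k (a 0)).
  by rewrite /M => *; apply/andP; split; lra.
by rewrite ltey_eq (integrable_fin_num mS icy).
Qed.

Variable x : 'I_J.+1 -> 'I_K.+1 -> R -> R.
Hypothesis x_eq : equilibrium S mu supply demand c x.

Let x_feas : feasible S mu supply demand x.
Proof. by case: x_eq. Qed.

Let cost_le : (total_cost S c x <= total_cost S c y)%E.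
Proof. by case: x_eq => _; apply; exact: block_flow_feasible. Qed.

Let reduced (w : R) (z : 'I_J.+1 -> 'I_K.+1 -> R -> R) (s : R) : R :=
  \sum_j \sum_k (fine (c j k s) + u j - v k - w) * z j k s.

Let reduced_pair w z s : s <= 0 ->
  reduced w z s = \sum_(p : 'I_J.+1 * 'I_K.+1) (V p.1 p.2 s - w) * z p.1 p.2 s.
Proof.
move=> s0; rewrite /reduced -(pair_bigA _ (fun j k => (V j k s - w) * z j k s)).
by apply: eq_bigr => j _; apply: eq_bigr => k _; rewrite /c s0.
Qed.

(** Inside a cell, [y] puts all capacity on the unique minimizer (j, k), whose reduced cost is
    negative. This is the optimum of [greedy_linear_bound], attained by no other flow. *)
Let cell_reduced w s (j : 'I_J.+1) (k : 'I_K.+1) :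
  (forall j k, 0 <= x j k s) -> \sum_j \sum_k x j k s <= mu ->
  a j < s < a j.+1 -> b k < s < b k.+1 -> V j k s < w ->
  reduced w y s <= reduced w x s /\
  (reduced w x s = reduced w y s -> forall j' k', x j' k' s <> 0 <->
     j' = j /\ k' = k).
Proof.
move=> x0 xmu ajs bks Vw.
have s0 : s <= 0.
  by case/andP: ajs => _ /ltW/le_trans; apply; rewrite -a_end a_le.
have yjk : y j k s = mu.
  case/andP: ajs => h1 /ltW h2; case/andP: bks => h3 /ltW h4.
  by rewrite /y /block_flow !indicE !mem_setE !in_itv/= h1 h2 h3 h4 !mulr1.
have off (r : nat -> R) (n n' : nat) : (forall i i', (i <= i')%N -> r i <= r i') ->
    r n < s < r n.+1 -> n' <> n -> ~~ (r n' < s <= r n'.+1).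
  move=> r_le /andP[rs sr] neq; apply/negP => /andP[rs' sr'].
  have [nn'|n'n|//] := ltngtP n' n.
    by have := r_le _ _ nn'; lra.
  by have := r_le _ _ n'n; lra.
have y0 j' k' : (j', k') <> (j, k) -> y j' k' s = 0.
  move=> neq; apply: y_out; have [e|ne] := eqVneq j' j.
    right; apply: (off b k) => // ek; apply: neq; rewrite e; congr pair.
    exact: val_inj.
  by left; apply: (off a j) => // ej; move/eqP: ne; apply; exact: val_inj.
have Ey : reduced w y s = (V j k s - w) * mu.
  rewrite reduced_pair// (bigD1 (j, k))//= yjk big1 ?addr0// => -[j' k'] /= /eqP neq.
  by rewrite y0 ?mulr0.
rewrite Ey (reduced_pair _ _ s0).
have [||||le_min eq_min] := @greedy_linear_bound _ _
  (fun p : 'I_J.+1 * 'I_K.+1 => V p.1 p.2 s - w) (fun p => x p.1 p.2 s) mu (j, k).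
- by move=> [j' k'] /=.
- by rewrite -(pair_bigA _ (fun j k => x j k s)).
- by rewrite /= subr_lt0.
- move=> [j' k'] /eqP neq /=; rewrite ltrD2r; exact: V_min.
split => // /eq_min[/= xjk x_other] j' k'; split.
  move=> xn; suff : (j', k') = (j, k) by case.
  by apply/eqP; apply: contra_notT xn => /x_other.
by case=> -> ->; rewrite xjk; apply/eqP; rewrite gt_eqF.
Qed.

Lemma equilibrium_sorted : {ae lambda, forall s, S s ->
  (~ (a 0 <= s <= 0) -> forall j k, x j k s = 0) /\
  (forall (j : 'I_J.+1) (k : 'I_K.+1), a j < s < a j.+1 -> b k < s < b k.+1 ->
     forall j' k', x j' k' s <> 0 <-> j' = j /\ k' = k)}.
Proof.
have c_ge j k (s : R) : S s -> ((c0)%:E <= c j k s)%E.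
  by move=> _; rewrite /c; case: ifP => [s0|_]; rewrite ?leey// lee_fin C_ge.
have y_lty := block_flow_cost_lty.
have x_lty : (total_cost S c x < +oo)%E := le_lt_trans cost_le y_lty.
(* The price of time [w] is the least [V] at [a 0]; since [V] decreases in time, every type lies
   above [w] before [a 0]. *)
pose W (p : 'I_J.+1 * 'I_K.+1) := V p.1 p.2 (a 0).
have [p0 p0_min] : exists p0, forall p, W p0 <= W p.
  case: (@Order.TotalTheory.arg_minP _ _ _ (ord0, ord0) xpredT W isT) => p0 _ p0_min.
  by exists p0 => p; exact: p0_min.
pose w := W p0.
have [iHx IHx] :=
  reduced_cost_integral mS supply_sum demand_sum x_feas mc c_ge x_lty u v w.
have [iHy IHy] :=
  reduced_cost_integral mS supply_sum demand_sum block_flow_feasible mc c_ge y_lty u v w.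
have iD := integrableB mS iHx iHy.
have x_fin := flow_cost_fin_num mS x_feas mc c_ge x_lty.
have V_decr j k (s s' : R) : s < s' -> s' <= 0 -> V j k s' < V j k s.
  by move=> ss' s'0; rewrite /V -!addrA ltrD2r; exact: C_decr.
have cuts : {ae lambda, forall s,
    (forall i : 'I_J.+2, s <> a i) /\ (forall i : 'I_K.+2, s <> b i)}.
  by apply: ae_and; apply: ae_forall_fin => i; exact: ae_neq_point.
have good := ae_and (ae_and (flow_capacity x_feas) x_fin) cuts.
pose concl s := (~ (a 0 <= s <= 0) -> forall j k, x j k s = 0) /\
  (forall (j : 'I_J.+1) (k : 'I_K.+1), a j < s < a j.+1 -> b k < s < b k.+1 ->
     forall j' k', x j' k' s <> 0 <-> j' = j /\ k' = k).
have key : {ae lambda, forall s, S s -> 0 <= reduced w x s - reduced w y s /\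
    (reduced w x s - reduced w y s = 0 -> concl s)}.
  apply: ae_imply good => s [[xmu xf] [sa sb]] Ss.
  have x0 j k : 0 <= x j k s := flow_ge0 x_feas j k Ss.
  have xy0 : (forall j k, x j k s = 0) -> (forall j k, y j k s = 0) ->
      reduced w x s - reduced w y s = 0.
    move=> xs0 ys0; rewrite /reduced -sumrB big1// => j _; rewrite -sumrB big1// => k _.
    by rewrite xs0 ys0 subrr.
  have [s0|s_gt0] := leP s 0; last first.
    (* After time 0 the cost is +oo, so a finite product leaves only zero flow. *)
    have xs0 j k : x j k s = 0.
      have := xf Ss j k; rewrite /c leNgt s_gt0/=.
      have := x0 j k; rewrite le_eqVlt => /orP[/eqP<-//|xp].
      by rewrite gt0_mulye.
    have ys0 j k : y j k s = 0.
      apply: y_out; left; rewrite negb_and; apply/orP; right.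
      by rewrite -ltNge (le_lt_trans _ s_gt0)// -a_end a_le.
    rewrite xy0//; split=> // _; split=> // j k /andP[_ saj].
    have : s < 0 by rewrite (lt_le_trans saj)// -a_end a_le.
    by rewrite ltNge (ltW s_gt0).
  (* Before [a 0] the sorted flow is zero and all reduced costs are positive, so the difference is a
     sum of nonnegative terms, and it vanishes only with [x]. *)
  have [a0s|s_lt] := leP (a 0) s; last first.
    have ys0 j k : y j k s = 0.
      apply: y_out; left; rewrite negb_and -leNgt; apply/orP; left.
      by rewrite (le_trans (ltW s_lt))// a_le.
    have -> : reduced w y s = 0.
      by rewrite /reduced big1// => j _; rewrite big1// => k _; rewrite ys0 mulr0.
    have h_gt0 (p : 'I_J.+1 * 'I_K.+1) : 0 < V p.1 p.2 s - w.
      rewrite subr_gt0; apply: le_lt_trans (p0_min p) _; apply: V_decr s_lt _.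
      by rewrite -a_end a_le.
    have term_ge0 (p : 'I_J.+1 * 'I_K.+1) : true -> 0 <= (V p.1 p.2 s - w) * x p.1 p.2 s.
      by move=> _; rewrite mulr_ge0// ltW.
    rewrite subr0 reduced_pair//; split; first exact: sumr_ge0.
    move=> /eqP; rewrite psumr_eq0// => /allP Z; split => [_ j k|j k /andP[ajs _]].
      have := Z (j, k); rewrite mem_index_enum => /(_ isT)/=.
      by rewrite mulf_eq0 (gt_eqF (h_gt0 (j, k)))/= => /eqP.
    by move: s_lt; rewrite ltNge (le_trans (a_le _) (ltW ajs)).
  have aN0 : s <> a 0 := sa ord0.
  have aNJ : s <> a J.+1 := sa ord_max.
  have a0s' : a 0 < s by rewrite lt_neqAle a0s andbT eq_sym; apply/eqP.
  have s0' : s < a J.+1 by rewrite lt_neqAle a_end s0 andbT -a_end; apply/eqP.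
  (* After [a 0] the type [p0] has dropped below [w], and the active type is no more expensive than
     [p0]. *)
  have w_gt (j : 'I_J.+1) (k : 'I_K.+1) : a j < s < a j.+1 -> b k < s < b k.+1 ->
      V j k s < w.
    move=> ajs bks; have V_p0 : V p0.1 p0.2 s < w := V_decr _ _ _ _ a0s' s0.
    apply: le_lt_trans V_p0; have [e|ne] := eqVneq (p0.1, p0.2) (j, k).
      by case: e => -> ->.
    by apply/ltW/V_min => //; apply/eqP.
  have cell (j : 'I_J.+1) (k : 'I_K.+1) : a j < s < a j.+1 -> b k < s < b k.+1 ->
      reduced w y s <= reduced w x s /\
      (reduced w x s = reduced w y s -> forall j' k', x j' k' s <> 0 <->
        j' = j /\ k' = k).
    by move=> ajs bks; apply: cell_reduced => //; [exact: xmu|exact: w_gt].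
  have [|i iJ|j jJ ajs] := @interval_cover _ a J s a_le; first by rewrite a0s'.
    exact: (sa (Ordinal iJ)).
  have [|i iK|k kK bks] := @interval_cover _ b K s b_le.
    by rewrite -ab_start a0s' b_end -a_end.
    exact: (sb (Ordinal iK)).
  have [le_yx _] := cell (Ordinal jJ) (Ordinal kK) ajs bks.
  split; first by rewrite subr_ge0.
  move=> /eqP; rewrite subr_eq0 => /eqP e; split; first by rewrite a0s s0.
  by move=> j' k' ajs' bks'; have [_] := cell j' k' ajs' bks'; apply.
(* The dual constants cancel, so the nonnegative difference integrates to cost of [x] minus cost of
   [y], at most 0 by optimality. *)
have D0 : {ae lambda, forall s, S s -> (reduced w x s - reduced w y s)%:E = 0%E}.
  apply: (ae_ge0_integral_le0 mS iD).
    by apply: ae_imply key => s H /H[]; rewrite -EFinB lee_fin.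
  rewrite (integralB mS iHx iHy) leeBlDr ?(integrable_fin_num mS iHy)// add0e.
  by rewrite IHx IHy; apply: leeD2r.
apply: ae_imply (ae_and key D0) => s [H1 H2] Ss.
by have [_] := H1 Ss; apply; case: (H2 Ss).
Qed.
End sorted_equilibrium.

(** * The commuting cost *)

Section commuting_cost.
Context {R : realType} {J K : nat}.
Variables (l : 'I_J.+1 -> R) (alpha beta gamma : 'I_K.+1 -> R) (f g : R -> R).
Hypothesis l_decr : forall j j' : 'I_J.+1, (j < j')%N -> l j' < l j.
Hypothesis alpha_incr : forall k k' : 'I_K.+1, (k < k')%N -> alpha k < alpha k'.
Hypotheses (beta_gt0 : forall k, 0 < beta k)
  (beta_incr : forall k k' : 'I_K.+1, (k < k')%N -> beta k < beta k').
Hypotheses (gamma_gt0 : forall k, 0 < gamma k)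
  (gamma_incr : forall k k' : 'I_K.+1, (k < k')%N -> gamma k < gamma k').
Let L := - l ord_max.
Hypothesis f_decr : forall s s', s < s' -> s' <= 0 -> f s' < f s.
Hypothesis g_decr : forall t t', t < t' -> t' <= L -> g t' < g t.
Hypothesis g_gap_incr : forall d t t', 0 < d -> t < t' -> t' <= L ->
  g (t - d) - g t < g (t' - d) - g t'.

Definition commute_cost j k s := alpha k * l j + beta k * f s + gamma k * g (s - l j).

Let l_le (j j' : 'I_J.+1) : (j <= j')%N -> l j' <= l j.
Proof.
rewrite leq_eqVlt => /orP[/eqP/val_inj->//|jj']; exact/ltW/l_decr.
Qed.

Let incr_le (r : 'I_K.+1 -> R) : (forall k k' : 'I_K.+1, (k < k')%N -> r k < r k') ->
  forall k k' : 'I_K.+1, (k <= k')%N -> r k <= r k'.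
Proof.
move=> r_incr k k'; rewrite leq_eqVlt => /orP[/eqP/val_inj->//|kk'].
exact/ltW/r_incr.
Qed.

Lemma shift_le_L (j : 'I_J.+1) s : s <= 0 -> s - l j <= L.
Proof.
by move=> s0; have := @l_le j ord_max (leq_ord j); rewrite /L; lra.
Qed.

Lemma commute_cost_decr j k s s' : s < s' -> s' <= 0 ->
  commute_cost j k s' < commute_cost j k s.
Proof.
move=> ss' s'0; rewrite /commute_cost; apply: ltrD.
  by rewrite ltrD2l ltr_pM2l// f_decr.
by rewrite ltr_pM2l// g_decr ?shift_le_L// ltrD2r.
Qed.

(** The [f] terms cancel. What remains is [alpha k] times the travel time difference plus [gamma k]
    times a gap of [g], which is positive by monotonicity and grows with time by concavity. *)
Lemma commute_cost_row (j j' : 'I_J.+1) (k k' : 'I_K.+1) s s' :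
  (j < j')%N -> (k <= k')%N -> s < s' -> s' <= 0 ->
  commute_cost j k s - commute_cost j' k s <
  commute_cost j k' s' - commute_cost j' k' s'.
Proof.
move=> jj' kk' ss' s'0; rewrite /commute_cost.
pose d := l j - l j'.
have d0 : 0 < d by rewrite subr_gt0 l_decr.
have s'L := shift_le_L j' s'0.
have gap := @g_gap_incr d (s - l j') (s' - l j') d0 ltac:(by rewrite ltrD2r) s'L.
have tL : s - l j' < L by lra.
have gap0 : g (s - l j') < g (s - l j' - d) by apply: g_decr; [lra|exact: ltW].
move: gap gap0; rewrite (_ : s - l j' - d = s - l j); last by rewrite /d; ring.
rewrite (_ : s' - l j' - d = s' - l j); last by rewrite /d; ring.
set p := g (s - l j); set q := g (s - l j').
set p' := g (s' - l j); set q' := g (s' - l j') => gap gap0.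
have h1 : alpha k * d <= alpha k' * d by rewrite ler_pM2r// incr_le.
have h2 : gamma k * (p - q) < gamma k * (p' - q') by rewrite ltr_pM2l.
have h3 : gamma k * (p' - q') <= gamma k' * (p' - q').
  by rewrite ler_wpM2r ?incr_le//; lra.
move: h1 h2 h3; rewrite /d !mulrBr; lra.
Qed.

(** The increments of the three coefficients multiply l(j), f(s) and g(s - l(j)); none of these
    grows with j, and the last two fall strictly with s. *)
Lemma commute_cost_col (j j' : 'I_J.+1) (k k' : 'I_K.+1) s s' :
  (k < k')%N -> (j <= j')%N -> s < s' -> s' <= 0 ->
  commute_cost j k s - commute_cost j k' s <
  commute_cost j' k s' - commute_cost j' k' s'.
Proof.
move=> kk' jj' ss' s'0; rewrite /commute_cost.
have h1 : (alpha k' - alpha k) * l j' <= (alpha k' - alpha k) * l j.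
  by rewrite ler_pM2l ?l_le// subr_gt0 alpha_incr.
have h2 : (beta k' - beta k) * f s' < (beta k' - beta k) * f s.
  by rewrite ltr_pM2l ?f_decr// subr_gt0 beta_incr.
have h3 : (gamma k' - gamma k) * g (s' - l j') < (gamma k' - gamma k) * g (s - l j).
  rewrite ltr_pM2l ?g_decr ?shift_le_L// ?subr_gt0 ?gamma_incr//.
  by have := l_le jj'; lra.
move: h1 h2 h3; rewrite !mulrBl; lra.
Qed.

Hypothesis f_ge0 : forall s, s <= 0 -> 0 <= f s.
Hypothesis g_gt0 : forall t, t <= L -> 0 < g t.

(** Only the travel time term can be negative; adding all absolute values gives one bound for all
    types. *)
Lemma commute_cost_ge j k s : s <= 0 ->
  - (\sum_j \sum_k `|alpha k * l j|) <= commute_cost j k s.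
Proof.
move=> s0; rewrite /commute_cost.
have h1 : `|alpha k * l j| <= \sum_j \sum_k `|alpha k * l j|.
  rewrite (bigD1 j)//= (bigD1 k)//= -addrA lerDl addr_ge0// sumr_ge0// => *.
  by rewrite sumr_ge0.
have h2 : 0 <= beta k * f s by rewrite mulr_ge0 ?f_ge0// ltW.
have h3 : 0 <= gamma k * g (s - l j) by rewrite mulr_ge0 ?ltW ?g_gt0 ?shift_le_L.
by have := ler_norm (- (alpha k * l j)); rewrite normrN; lra.
Qed.

Hypothesis f_cont : {within [set s : R | s <= 0], continuous f}.
Hypothesis g_cont : {within [set t : R | t <= L], continuous g}.

Lemma measurable_disutility (S : set R) j k :
  @measurable _ (measurableTypeR R) S ->
  measurable_fun S (disutility l alpha beta gamma f g j k).
Proof.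
move=> mS.
have mneg (c : R) : @measurable _ (measurableTypeR R) [set s : R | s <= c].
  by rewrite (_ : [set s | s <= c] = `]-oo, c]%classic)//; exact: measurable_itv.
have mf : measurable_fun [set s : R | s <= 0] f.
  by apply: subspace_continuous_measurable_fun => //; exact: mneg.
have mg : measurable_fun [set t : R | t <= L] g.
  by apply: subspace_continuous_measurable_fun => //; exact: mneg.
have mgl : measurable_fun [set s : R | s <= 0] (fun s => g (s - l j)).
  apply: (measurable_comp (mneg L) _ mg).
    by move=> _ [s /= s0 <-]; exact: shift_le_L.
  by apply: measurable_funB.
have mC : measurable_fun [set s : R | s <= 0] (commute_cost j k).
  apply: measurable_funD; last exact: measurable_funM.
  by apply: measurable_funD => //; exact: measurable_funM.
rewrite /disutility; apply: measurable_fun_if => //.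
- by apply: measurable_fun_ler.
- apply/measurable_EFinP; apply: (measurable_funS (mneg 0)) mC.
  by move=> s [].
Qed.

End commuting_cost.

(** * The sorting property for the groups of the northwest corner rule *)

Set Strict Implicit.
Unset Implicit Arguments.

Theorem proposition7p3 (R : realType) (J K : nat)
  (l : 'I_J.+1 -> R) (alpha beta gamma : 'I_K.+1 -> R) (f g : R -> R)
  (S : set R) (mu Q T : R) (supply : 'I_J.+1 -> R) (demand : 'I_K.+1 -> R)
  (x : 'I_J.+1 -> 'I_K.+1 -> R -> R)
  (l_decr : forall j j' : 'I_J.+1, (j < j')%N -> l j' < l j)
  (alpha_gt0 : forall k, 0 < alpha k)
  (alpha_incr : forall k k' : 'I_K.+1, (k < k')%N -> alpha k < alpha k')
  (beta_gt0 : forall k, 0 < beta k)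
  (beta_incr : forall k k' : 'I_K.+1, (k < k')%N -> beta k < beta k')
  (gamma_gt0 : forall k, 0 < gamma k)
  (gamma_incr : forall k k' : 'I_K.+1, (k < k')%N -> gamma k < gamma k')
  (f_cont : {within [set s : R | s <= 0], continuous f})
  (f_ge0 : forall s, s <= 0 -> 0 <= f s)
  (f_deriv : exists f1 : R -> R, forall s, s <= 0 ->
     has_deriv_within [set s' : R | s' <= 0] f s (f1 s) /\ f1 s < 0)
  (g_cont : {within [set t : R | t <= - l ord_max], continuous g})
  (g_gt0 : forall t, t <= - l ord_max -> 0 < g t)
  (g_deriv : exists g1 g2 : R -> R, forall t, t <= - l ord_max ->
     [/\ has_deriv_within [set t' : R | t' <= - l ord_max] g t (g1 t),
         has_deriv_within [set t' : R | t' <= - l ord_max] g1 t (g2 t),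
         g1 t < 0 & g2 t < 0])
  (mu_gt0 : 0 < mu)
  (supply_gt0 : forall j, 0 < supply j)
  (demand_gt0 : forall k, 0 < demand k)
  (supply_sum : \sum_(j < J.+1) supply j = Q)
  (demand_sum : \sum_(k < K.+1) demand k = Q)
  (T_def : T = Q / mu)
  (S_interval : is_interval S)
  (S_long : [set s : R | - T <= s <= 0] `<=` S)
  (x_eq : equilibrium S mu supply demand
            (disutility l alpha beta gamma f g) x) :
  exists I : nat,
    [/\ nwc_stops supply demand Q I,
        (forall i, (i < I)%N ->
           switch_time supply demand mu T i.+1 - switch_time supply demand mu T i
             = group_mass supply demand i / mu /\
           {ae lebesgue_measure, forall s : R,
              switch_time supply demand mu T i <= s
                <= switch_time supply demand mu T i.+1 ->
              forall j k, x j k s <> 0 <->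
                j = group_loc supply demand i /\ k = group_job supply demand i}),
        {ae lebesgue_measure, forall s : R, S s -> ~ (- T <= s <= 0) ->
           forall j k, x j k s = 0} &
        [/\ switch_time supply demand mu T 0 = - T,
            (forall i, (i < I)%N -> switch_time supply demand mu T i
                                      < switch_time supply demand mu T i.+1) &
            switch_time supply demand mu T I = 0]].
Proof.
have f_decr : forall s s', s < s' -> s' <= 0 -> f s' < f s.
  by case: f_deriv => f1; exact: has_deriv_within_decreasing.
have g_decr : forall t t', t < t' -> t' <= - l ord_max -> g t' < g t.
  case: g_deriv => g1 [g2 gd]; apply: (@has_deriv_within_decreasing _ _ _ g1) => //.
  by move=> t /gd[].
have g_gap : forall d t t', 0 < d -> t < t' -> t' <= - l ord_max ->
    g (t - d) - g t < g (t' - d) - g t'.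
  case: g_deriv => g1 [g2 gd]; apply: (@concave_shift_increasing _ _ _ g1 g2) => //.
  by move=> t /gd[].
have mS : @measurable _ (measurableTypeR R) S := is_interval_measurable S_interval.
(* Were the locations served one after another at full capacity from -T on, [a n] would be the start
   of location n; [b] is the analogue for jobs. *)
pose a n := cumulative supply n / mu - T.
pose b n := cumulative demand n / mu - T.
have a_incr n : a n < a n.+1.
  by rewrite ltrD2r ltr_pM2r ?invr_gt0// cumulative_lt.
have b_incr n : b n < b n.+1.
  by rewrite ltrD2r ltr_pM2r ?invr_gt0// cumulative_lt.
have a_start : a 0%N = - T by rewrite /a /cumulative big_ord0 mul0r add0r.
have b_start : b 0%N = - T by rewrite /b /cumulative big_ord0 mul0r add0r.
have a_end : a J.+1 = 0 by rewrite /a cumulative_total supply_sum T_def subrr.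
have b_end : b K.+1 = 0 by rewrite /b cumulative_total demand_sum T_def subrr.
have supplyE (j : 'I_J.+1) : supply j = mu * (a j.+1 - a j).
  rewrite /a cumulativeS inord_val opprD addrACA subrr addr0 -mulrBl addrC addKr.
  by rewrite mulrC divfK// gt_eqF.
have demandE (k : 'I_K.+1) : demand k = mu * (b k.+1 - b k).
  rewrite /b cumulativeS inord_val opprD addrACA subrr addr0 -mulrBl addrC addKr.
  by rewrite mulrC divfK// gt_eqF.
pose C (n m : nat) s := commute_cost l alpha beta gamma f g (inord n) (inord m) s.
have [|m n n' s s' mK /andP[nn' n'J] ss' s'0|u [v uv]] :=
    @sorting_potentials R J K C a b 0 a_incr b_incr a_end b_end.
- move=> n m m' s s' nJ /andP[mm' m'K] ss' s'0.
  have mK := leq_trans mm' m'K; have nJ1 := ltnW nJ.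
  by apply: commute_cost_row => //; rewrite !inordK.
- have nJ := leq_trans nn' n'J; have mK1 := ltnW mK.
  by apply: commute_cost_col => //; rewrite !inordK.
have V_min (j : 'I_J.+1) (k : 'I_K.+1) s :
    a j < s < a j.+1 -> b k < s < b k.+1 ->
    forall j' k', (j', k') <> (j, k) ->
    commute_cost l alpha beta gamma f g j k s + u j - v k <
    commute_cost l alpha beta gamma f g j' k' s + u j' - v k'.
  move=> ajs bks j' k' neq.
  have := uv j k s (leq_ord j) (leq_ord k) ajs bks j' k' (leq_ord j') (leq_ord k').
  rewrite /C !inord_val; apply => -[ej ek]; apply: neq.
  by congr pair; exact: val_inj.
have sorted : {ae lebesgue_measure, forall s, S s ->
  (~ (a 0%N <= s <= 0) -> forall j k, x j k s = 0) /\
  (forall (j : 'I_J.+1) (k : 'I_K.+1), a j < s < a j.+1 -> b k < s < b k.+1 ->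
     forall j' k', x j' k' s <> 0 <-> j' = j /\ k' = k)}.
  apply: (@equilibrium_sorted R J K S mu Q supply demand
    (commute_cost l alpha beta gamma f g) a b
    (- (\sum_j \sum_k `|alpha k * l j|)) mS mu_gt0 supply_sum demand_sum
    a_incr b_incr _ a_end b_end supplyE demandE _ _ _ _
    (fun j => u j) (fun k => v k) V_min x x_eq).
  - by rewrite a_start b_start.
  - by rewrite a_start.
  - by move=> j k; exact: measurable_disutility.
  - by move=> j k s s'; exact: commute_cost_decr.
  - by move=> j k s; exact: commute_cost_ge.
have [I [stops groups]] :=
  nwc_groups supply_gt0 demand_gt0 supply_sum demand_sum.
have switch_lt i : (i < I)%N ->
    switch_time supply demand mu T i < switch_time supply demand mu T i.+1.
  by move=> /groups[_ _ GG _]; rewrite ltrD2r ltr_pM2r ?invr_gt0.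
exists I; split => //.
- move=> i iI; split.
    by rewrite /switch_time big_ord_recr/=; ring.
  (* The interval of group i lies inside both the interval of its location and that of its job. *)
  have [AG BG _ GAB] := groups i iI.
  set j0 := group_loc supply demand i in AG GAB *.
  set k0 := group_job supply demand i in BG GAB *.
  have le_scale p q : p <= q -> p / mu - T <= q / mu - T.
    by move=> pq; rewrite lerD2r ler_pM2r ?invr_gt0.
  have aG : a j0 <= switch_time supply demand mu T i by exact: le_scale.
  have bG : b k0 <= switch_time supply demand mu T i by exact: le_scale.
  have Ga : switch_time supply demand mu T i.+1 <= a j0.+1.
    by apply: le_scale; rewrite GAB ge_min lexx.
  have Gb : switch_time supply demand mu T i.+1 <= b k0.+1.
    by apply: le_scale; rewrite GAB ge_min lexx orbT.
  (* The group interval is closed whereas [sorted] concerns open cells; the two endpoints are a null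
     set. *)
  have ends := ae_and (ae_neq_point (switch_time supply demand mu T i))
    (ae_neq_point (switch_time supply demand mu T i.+1)).
  apply: ae_imply (ae_and ends sorted) => s [[/eqP s_neq /eqP s_neq'] H] /andP[si si'].
  have {}si : switch_time supply demand mu T i < s by rewrite lt_neqAle eq_sym s_neq.
  have {}si' : s < switch_time supply demand mu T i.+1 by rewrite lt_neqAle s_neq'.
  have ajs := le_lt_trans aG si; have saj := lt_le_trans si' Ga.
  have bks := le_lt_trans bG si; have sbk := lt_le_trans si' Gb.
  have Ss : S s.
    apply: S_long => /=; rewrite -a_start -a_end.
    rewrite (le_trans _ (ltW ajs)) ?(le_trans (ltW saj))//.
      by rewrite lerD2r ler_pM2r ?invr_gt0// cumulative_le.
    by rewrite lerD2r ler_pM2r ?invr_gt0// cumulative_le.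
  have [_ Hs] := H Ss.
  by move=> j k; apply: Hs; rewrite ?ajs ?saj ?bks ?sbk.
- by apply: ae_imply sorted => s H Ss; have [] := H Ss; rewrite a_start.
split => //; first by rewrite /switch_time big_ord0 mul0r add0r.
by case: stops => _ sumQ _; rewrite /switch_time sumQ T_def subrr.
Qed.
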